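(* Let $G$ be a finite graph and $\mathcal{IS}(G)$ the set of independent sets of $G$. If $G$ is connected, then $\mathcal{IS}(G)$ is toggle-alternating. If $G$ has components $G_1,G_2,\ldots,G_k$, then $T(\mathcal{IS}(G))\cong T(\mathcal{IS}(G_1))\times T(\mathcal{IS}(G_2))\times\cdots\times T(\mathcal{IS}(G_k))$.
   Context: An independent set in a graph $G$ is a subset of the vertices such that no two have an edge between them. $\mathcal{IS}(G)\subseteq 2^{V(G)}$, with ground set the vertex set $V(G)$. For a finite set $E$ and $\mathcal{L}\subseteq 2^E$, the toggle of $e\in E$ is the map $t_e:\mathcal{L}\to\mathcal{L}$ with $t_e(X)=X\cup\{e\}$ if $e\notin X$ and $X\cup\{e\}\in\mathcal{L}$; $t_e(X)=X\setminus\{e\}$ if $e\in X$ and $X\setminus\{e\}\in\mathcal{L}$; and $t_e(X)=X$ otherwise. The toggle group $T(\mathcal{L})$ is the subgroup of the symmetric group $\mathfrak{S}_{\mathcal{L}}$ generated by $\{t_e\mid e\in E\}$. $\mathcal{L}$ is toggle-alternating if $T(\mathcal{L})$ contains the alternating group $A_{\mathcal{L}}$. *)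

(* Defs.v *)
From HB Require Import structures.
From mathcomp Require Import all_boot all_fingroup all_solvable.

Set Implicit Arguments.
Unset Strict Implicit.
Unset Printing Implicit Defensive.

Local Open Scope group_scope.

Section Toggle.

Variables (E : finType) (L : {set {set E}}).

Definition member : finType := {X : {set E} | X \in L}.

Definition toggle_set (e : E) (X : {set E}) : {set E} :=
  if (e \notin X) && (e |: X \in L) then e |: X
  else if (e \in X) && (X :\ e \in L) then X :\ e
  else X.

Lemma toggle_set_in (e : E) (X : member) : toggle_set e (val X) \in L.
Proof.
rewrite /toggle_set; case: ifP => [/andP[]//|_].
by case: ifP => [/andP[]//|_]; exact: valP.
Qed.

Definition toggle (e : E) (X : member) : member :=
  exist _ (toggle_set e (val X)) (toggle_set_in e X).

Lemma toggleK (e : E) : involutive (toggle e).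
Proof.
move=> X; apply: val_inj; rewrite /= {2}/toggle_set.
have XL : val X \in L := valP X.
case: (boolP (e \in val X)) => eX /=; case: ifP => XeL; rewrite /toggle_set.
- by rewrite setD11 /= setD1K // XL.
- by rewrite eX /= XeL.
- by rewrite setU11 /= setU1K // XL.
- by rewrite (negPf eX) /= XeL.
Qed.

Definition toggle_perm (e : E) : {perm member} := perm (inv_inj (toggleK e)).

Definition toggle_group : {group {perm member}} :=
  <<[set toggle_perm e | e : E]>>%G.

Definition toggle_alternating : Prop := 'Alt_member \subset toggle_group.

End Toggle.

(* A finite simple graph is a symmetric irreflexive [adj : rel V]. *)
Section Graph.

Variables (V : finType) (adj : rel V).

Definition independent (X : {set V}) : bool :=
  [forall x in X, forall y in X, ~~ adj x y].

Definition independent_sets : {set {set V}} := [set X | independent X].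

(* The graph with no vertices counts as connected. *)
Definition connected_graph : Prop := forall x y : V, connect adj x y.

Definition components : {set {set V}} :=
  equivalence_partition (connect adj) [set: V].

Definition induced (C : {set V}) : rel {x : V | x \in C} :=
  fun x y => adj (val x) (val y).

End Graph.

(* Main.v *)
Require Import Defs.
From HB Require Import structures.
From mathcomp Require Import all_boot all_fingroup all_solvable.

(** Connected case: let IS(S) be the family of independent sets inside S, and let v
    be adjacent to some u in S. The sets of IS(v |: S) avoiding v form A = IS(S),
    those containing v form a copy of the smaller family B = IS(S minus the
    neighbours of v), and the toggles at the vertices of S act on both. As Alt_A is
    simple and too large to act nontrivially on B, a group element can induce any
    even permutation of A and fix the copy of B; conjugating 3-cycles by the toggle
    at v then reaches the sets containing v. This needs |A| > 4, which can only
    fail when some vertex is adjacent to all others; in that case a toggle is a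
    transposition and the toggle group is symmetric.

    General case: an independent set is a tuple of independent sets of the
    components, and componentwise application embeds the product of the symmetric
    groups so that a toggle in one factor becomes the toggle of G at that vertex. *)

Set Implicit Arguments.
Unset Strict Implicit.
Unset Printing Implicit Defensive.

Local Open Scope group_scope.

(** * Alternating groups: generation by 3-cycles, and subgroups of a product of two symmetric
    groups *)

(** The given products generate a group [C] that is normalised by the transposition [s] of [o1] and
    [o2] and that generates the symmetric group together with [s]. So [C] has index at most 2 and
    contains every even permutation. *)
Lemma Alt_sub_3cycles (D : finType) (T : {group {perm D}}) (o1 o2 : D) :
    o1 != o2 ->
    (forall x, x != o1 -> x != o2 -> tperm o1 o2 * tperm o1 x \in T) ->
  'Alt_D \subset T.
Proof.
move=> o12 T3.
pose s : {perm D} := tperm o1 o2.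
pose S := [set (s * tperm o1 x)%g | x in [pred x | (x != o1) && (x != o2)]].
pose C := <<S>>%G.
have CT : C \subset T.
  rewrite gen_subG; apply/subsetP => _ /imsetP[x /andP[x1 x2] ->].
  exact: T3.
apply: subset_trans CT.
have genC x : x != o1 -> x != o2 -> s * tperm o1 x \in C.
  by move=> x1 x2; apply/mem_gen/imset_f/andP.
have nCs : <[s]> \subset 'N(C).
  rewrite cycle_subG; apply/normP; apply/eqP.
  rewrite eqEcard cardJg leqnn andbT -genJ gen_subG.
  apply/subsetP => _ /imsetP[_ /imsetP[x /andP[x1 x2] ->] ->].
  (* Conjugation by [s] inverts each generator of [C]. *)
  suff -> : (s * tperm o1 x) ^ s = (s * tperm o1 x)^-1.
    by rewrite groupV genC.
  by rewrite /conjg invMg !tpermV !mulgA tperm2 mul1g.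
have allS : C <*> <[s]> = [set: {perm D}].
  apply/eqP; rewrite eqEsubset subsetT -(gen_tperm o1) gen_subG.
  have sC : s \in C <*> <[s]> by apply: (subsetP (joing_subr _ _)); exact: cycle_id.
  apply/subsetP => _ /imsetP[x _ ->].
  have [->|x1] := eqVneq x o1; first by rewrite tperm1 group1.
  have [->|x2] := eqVneq x o2; first exact: sC.
  have -> : tperm o1 x = s * (s * tperm o1 x) by rewrite mulgA tperm2 mul1g.
  by rewrite groupM //; apply: (subsetP (joing_subl _ _)); exact: genC.
have sV : s * s = 1 by exact: tperm2.
have evC p : p \in C -> ~~ odd_perm p.
  have : C \subset 'Alt_D.
    rewrite gen_subG; apply/subsetP => _ /imsetP[x /andP[x1 x2] ->].
    by rewrite Alt_even odd_permM !odd_tperm o12 eq_sym x1.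
  by move/subsetP => sub /sub; rewrite Alt_even.
apply/subsetP => p; rewrite Alt_even => evp.
have : p \in C * <[s]> by rewrite -norm_joinEr // allS inE.
(* In [p = c * s ^+ n] both [p] and [c] are even, so [n] is even and the power of [s] vanishes. *)
case/mulsgP => c t cC /cycleP[n ->] def_p.
move: evp; rewrite def_p odd_permM (negPf (evC c cC)) /=.
rewrite -(odd_double_half n) expgD -muln2 mulnC expgM expgS expg1 sV expg1n mulg1.
case: (odd n); last by rewrite expg0 mulg1.
by rewrite expg1 odd_tperm o12.
Qed.

(* Goursat: the image of the kernel of the second projection has index at most
   [(#|A| - 1)!] in that of H, too small for this normal subgroup to meet the
   simple group ['Alt_A] trivially. *)
Lemma Alt_fst_ker_snd (A B : finType) (H : {group {perm A} * {perm B}}) :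
    4 < #|A| -> #|B| < #|A| -> 'Alt_A \subset fst @* H ->
  forall p, p \in 'Alt_A -> (p, 1) \in H.
Proof.
move=> A5 BA sAlt.
pose f := [morphism of (@fst {perm A} {perm B})].
pose g := [morphism of (@snd {perm A} {perm B})].
pose K := 'ker_H g.
have nK : K <| H.
  by rewrite /normal subsetIl normsI ?normG ?(subset_trans (subsetT H)) ?ker_norm.
have nM : f @* K <| f @* H by exact: morphim_normal.
suff sAM : 'Alt_A \subset f @* K.
  move=> p /(subsetP sAM); case/morphimP=> -[a b] _ /setIP[abH].
  by move/kerP => /(_ (in_setT _)) /= b1 ->; rewrite /= -b1.
have nAM : f @* K :&: 'Alt_A <| 'Alt_A.
  rewrite /normal subsetIr normsI ?normG //.
  by apply: subset_trans sAlt (normal_norm nM).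
have [_ /(_ _ nAM)[M1|MA]] := simpleP _ (simple_Alt5 A5); last first.
  by rewrite -MA subsetIl.
have cardA : (2 * #|'Alt_A| = #|A|`!)%N by apply: card_Alt; apply: ltn_trans A5.
(* A subgroup meeting ['Alt_A] trivially has at most two elements, because ['Alt_A] has index 2. *)
have cardM : #|f @* K| <= 2.
  rewrite -(leq_pmul2r (cardG_gt0 'Alt_A)) cardA -card_Sym -TI_cardMg //.
  exact: subset_leq_card (subsetT _).
(* The index of [f @* K] in [f @* H] divides that of [K] in [H], which is the order of [g @* H]. *)
have cardH : #|f @* H| <= 2 * #|B|`!.
  rewrite -(Lagrange (normal_sub nM)) leq_mul //.
  apply: leq_trans (dvdn_leq _ (index_morphim _ _)) _ => //.
    exact: subsetT.
  rewrite indexgI -{1}[H : {set _}]setTI -(card_morphim g H).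
  by rewrite -card_Sym subset_leq_card // subsetT.
(* The factor 4 is the index of ['Alt_A] times the bound 2 on the order of [f @* K]; the inequality
   would force [#|A| <= 4]. *)
have : #|A|`! <= 4 * (#|A|.-1)`!.
  rewrite -cardA -[4]/(2 * 2)%N -mulnA leq_mul2l /=.
  apply: leq_trans (subset_leq_card sAlt) (leq_trans cardH _).
  by rewrite leq_mul2l /= leq_fact // -ltnS prednK // (leq_ltn_trans _ BA).
rewrite -{1}(prednK (ltn_trans (isT : 0 < 4) A5)) factS prednK ?(ltn_trans _ A5) //.
by rewrite leq_pmul2r ?fact_gt0 // leqNgt A5.
Qed.

(** * Toggles as permutations, and membership after a toggle *)

Definition to_member (E : finType) (L : {set {set E}}) (X : {set E}) (XL : X \in L) :
  member L := exist _ X XL.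

Lemma toggle_permE (E : finType) (L : {set {set E}}) (e : E) (X : member L) :
  val (toggle_perm L e X) = toggle_set L e (val X).
Proof. by rewrite permE. Qed.

Lemma toggle_permK (E : finType) (L : {set {set E}}) (e : E) :
  involutive (toggle_perm L e).
Proof. by move=> X; rewrite !permE toggleK. Qed.

Lemma mem_toggle_group (E : finType) (L : {set {set E}}) (e : E) :
  toggle_perm L e \in toggle_group L.
Proof. exact/mem_gen/imset_f. Qed.

(** In a hereditary family removal is always allowed; only insertion can be blocked. *)
Lemma in_toggle_set (E : finType) (L : {set {set E}}) (e x : E) (X : {set E}) :
    (forall Y Z : {set E}, Y \subset Z -> Z \in L -> Y \in L) -> X \in L ->
  (x \in toggle_set L e X) =
    (if x == e then (e \notin X) && (e |: X \in L) else x \in X).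
Proof.
move=> hered XL; rewrite /toggle_set.
have -> : X :\ e \in L by apply: hered XL; exact: subsetDl.
case: (boolP (e \in X)) => eX /=.
  by rewrite !inE; case: eqP.
case: ifP => _; first by rewrite !inE; case: eqP.
by case: eqP => // ->; apply: negbTE.
Qed.

(** * Independent sets inside a vertex subset *)

Section IndependentSets.

Variables (V : finType) (adj : rel V).
Hypotheses (adj_sym : symmetric adj) (adj_irr : irreflexive adj).

Lemma independentP (X : {set V}) :
  reflect {in X &, forall x y, ~~ adj x y} (independent adj X).
Proof.
apply: (iffP forall_inP) => [iX x y xX yX | iX x xX].
  by move/forall_inP: (iX x xX); apply.
by apply/forall_inP => y yX; apply: iX.
Qed.

Lemma independent_hereditary (Y Z : {set V}) :
  Y \subset Z -> Z \in independent_sets adj -> Y \in independent_sets adj.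
Proof.
move=> /subsetP YZ; rewrite !inE => /independentP iZ.
by apply/independentP => x y /YZ xZ /YZ; apply: iZ.
Qed.

Lemma independent_set0 : set0 \in independent_sets adj.
Proof. by rewrite inE; apply/independentP => x y; rewrite inE. Qed.

Lemma independent_set1 (x : V) : [set x] \in independent_sets adj.
Proof.
by rewrite inE; apply/independentP => y z /set1P-> /set1P->; rewrite adj_irr.
Qed.

Lemma independent_setU1 (v : V) (X : {set V}) :
  (v |: X \in independent_sets adj) =
    (X \in independent_sets adj) && [forall x in X, ~~ adj v x].
Proof.
rewrite !inE; apply/independentP/andP => [iX | [/independentP iX vX] x y].
  split; first by apply/independentP => x y xX yX; apply: iX; exact: setU1r.
  by apply/forall_inP => x xX; apply: iX; [exact: setU11 | exact: setU1r].
case/setU1P=> [->|xX] /setU1P[->|yX]; first by rewrite adj_irr.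
- exact: (forall_inP vX).
- by rewrite adj_sym; exact: (forall_inP vX).
- exact: iX.
Qed.

(** All these families keep the ground set [V], so those for different [S] can be compared without
    passing through subtypes. *)
Definition independent_within (S : {set V}) : {set {set V}} :=
  [set X in independent_sets adj | X \subset S].

Local Notation IS := independent_within.

Lemma independent_withinT : IS setT = independent_sets adj.
Proof. by apply/setP => X; rewrite inE subsetT andbT. Qed.

Lemma within_hereditary (S Y Z : {set V}) :
  Y \subset Z -> Z \in IS S -> Y \in IS S.
Proof.
move=> YZ; rewrite ![_ \in IS S]inE => /andP[iZ ZS].
by rewrite (independent_hereditary YZ iZ) (subset_trans YZ ZS).
Qed.

Lemma within_set0 (S : {set V}) : set0 \in IS S.
Proof. by rewrite inE independent_set0 sub0set. Qed.

Lemma within_set1 (S : {set V}) (x : V) : x \in S -> [set x] \in IS S.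
Proof. by move=> xS; rewrite inE independent_set1 sub1set. Qed.

Lemma within_set2 (S : {set V}) (x y : V) :
  x \in S -> y \in S -> ~~ adj x y -> [set x; y] \in IS S.
Proof.
move=> xS yS nxy; rewrite inE independent_setU1 independent_set1 subUset !sub1set.
rewrite xS yS !andbT /=; apply/forallP => z.
by apply/implyP => /set1P->.
Qed.

Lemma within_setU1_adj (S X : {set V}) (u v : V) :
  u \in X -> adj v u -> v |: X \notin IS S.
Proof.
move=> uX avu; rewrite inE independent_setU1 negb_and negb_and.
by apply/orP; left; apply/orP; right; apply/forall_inPn; exists u => //; rewrite avu.
Qed.

(** The neighbour [u] blocks the insertion of [v] and excludes that [v] is already present. This
    supplies the fixed points used when conjugating by toggles. *)
Lemma toggle_within_adj (S : {set V}) (u v : V) (X : member (IS S)) :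
  u \in val X -> adj v u -> toggle_perm (IS S) v X = X.
Proof.
move=> uX avu; apply: val_inj; rewrite toggle_permE /toggle_set.
rewrite (negPf (within_setU1_adj S uX avu)) andbF ifF //; apply/negbTE.
rewrite negb_and; have [vX|//] := boolP (v \in val X).
move: (valP X); rewrite !inE => /andP[/independentP/(_ v u vX uX)].
by rewrite avu.
Qed.

Lemma toggle_within_notin (S : {set V}) (e : V) :
  e \notin S -> toggle_perm (IS S) e = 1.
Proof.
move=> eS; apply/permP => X; rewrite perm1; apply: val_inj.
rewrite toggle_permE /toggle_set.
have eX : e \notin val X.
  by move: (valP X); rewrite inE => /andP[_ /subsetP XS]; apply: contra eS; exact: XS.
by rewrite [_ |: _ \in _]inE subUset sub1set (negPf eS) (negPf eX) /= andbF.
Qed.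

(* If u is adjacent to the rest of S, then toggling at u transposes the empty set
   and {u}; the toggle at any x in X fixes {u}, so conjugating turns the
   transposition of {u} with X :\ x into that of {u} with X. *)
Lemma toggle_group_dominating (S : {set V}) (u : V) :
    u \in S -> {in S, forall x, x != u -> adj x u} ->
  toggle_group (IS S) = [set: {perm member (IS S)}] :> {set _}.
Proof.
move=> uS domu.
pose m0 : member (IS S) := to_member (within_set0 S).
pose mu : member (IS S) := to_member (within_set1 uS).
have only_u (X : member (IS S)) : u \in val X -> X = mu.
  move=> uX; apply/val_inj/setP => x /=; rewrite inE; apply/idP/eqP => [xX|->//].
  apply/eqP; apply: contraT => xu.
  move: (valP X); rewrite !inE => /andP[/independentP iX /subsetP XS].
  by have := domu x (XS _ xX) xu; rewrite (negPf (iX x u xX uX)).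
have tuE : toggle_perm (IS S) u = tperm mu m0.
  apply/permP => X; apply: val_inj; rewrite toggle_permE /toggle_set.
  case: tpermP => [->|->|/eqP Xu /eqP X0] /=.
  - by rewrite inE eqxx /= setDv within_set0.
  - by rewrite inE setU0 within_set1.
  have uX : u \notin val X by apply: contra Xu => /only_u->.
  rewrite uX /= ifF // ?(negPf uX) //; apply/negbTE.
  have [x xX] : exists x, x \in val X.
    by apply/set0Pn; apply: contra X0 => /eqP X0; apply/eqP/val_inj.
  have xS : x \in S by move: (valP X); rewrite inE => /andP[_ /subsetP]; apply.
  apply: (within_setU1_adj _ xX); rewrite adj_sym domu //.
  by apply: contraNneq uX => <-.
apply/eqP; rewrite eqEsubset subsetT -(gen_tperm mu) gen_subG.
apply/subsetP => _ /imsetP[X _ ->].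
have [n] := ubnP #|val X|; elim: n X => // n IHn X.
rewrite ltnS => leXn.
have [uX|uX] := boolP (u \in val X); first by rewrite (only_u X uX) tperm1 group1.
have [X0|[x xX]] := set_0Vmem (val X).
  have -> : X = m0 by apply: val_inj.
  by rewrite -tuE mem_toggle_group.
have xu : x != u by apply: contraNneq uX => <-.
have xS : x \in S by move: (valP X); rewrite inE => /andP[_ /subsetP]; apply.
pose Y : member (IS S) :=
  to_member (within_hereditary (subsetDl _ [set x]) (valP X)).
have tY : toggle_perm (IS S) x Y = X.
  apply: val_inj; rewrite toggle_permE /toggle_set /= setD11 setD1K // ifT //.
  exact: valP.
have tmu : toggle_perm (IS S) x mu = mu.
  by apply: (@toggle_within_adj S u) => //=; rewrite ?set11 ?domu.
rewrite -tY -{1}tmu -tpermJ groupJ ?mem_toggle_group // IHn //=.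
by rewrite (cardsD1 x) xX in leXn.
Qed.

(** * Adding one vertex to [S] *)

Lemma within_setU1 (S Z : {set V}) (v : V) :
  v \notin Z -> (Z \in IS (v |: S)) = (Z \in IS S).
Proof.
move=> vZ; rewrite ![_ \in IS _]inE; congr (_ && _).
by rewrite -subDset (setDidPl _) // disjoint_sym disjoints1.
Qed.

Lemma setU1_within_setU1 (S Z : {set V}) (v : V) :
  v \notin Z ->
  (v |: Z \in IS (v |: S)) = (Z \in IS (S :\: [set x | adj v x])).
Proof.
move=> vZ; rewrite ![_ \in IS _]inE independent_setU1 -andbA; congr (_ && _).
rewrite subsetD andbC subUset sub1set setU11 /= -subDset.
have -> : Z :\ v = Z by apply/setDidPl; rewrite disjoint_sym disjoints1.
congr (_ && _).
apply/forall_inP/pred0P => [nv x | nv x xZ] /=.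
  by rewrite inE; apply/negP => /andP[/nv /negP].
by apply/negP => avx; move: (nv x); rewrite /= inE xZ avx.
Qed.

(** The non-neighbour [w] gives a second set containing [u] besides the singleton. Both are fixed by
    the toggle at [v], so conjugating by it moves only the third point of a 3-cycle. *)
Lemma toggle_alternating_setU1 (S : {set V}) (u v w : V) :
    v \notin S -> u \in S -> adj v u -> w \in S -> w != u -> ~~ adj u w ->
    4 < #|IS S| -> toggle_alternating (IS S) ->
  toggle_alternating (IS (v |: S)).
Proof.
move=> vS uS avu wS wu nuw S5 altS.
pose N := [set x | adj v x].
pose A := member (IS S); pose B := member (IS (S :\: N)).
pose D := member (IS (v |: S)).
have vA (X : A) : v \notin val X.
  by move: (valP X); rewrite inE => /andP[_ /subsetP XS]; apply: contra vS; exact: XS.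
have vB (Y : B) : v \notin val Y.
  move: (valP Y); rewrite inE => /andP[_ /subsetP YS]; apply: contra vS.
  by move/YS/setDP=> [].
have inAP (X : A) : val X \in IS (v |: S) by rewrite within_setU1 // (valP X).
have inBP (Y : B) : v |: val Y \in IS (v |: S).
  by rewrite setU1_within_setU1 // (valP Y).
pose inA (X : A) : D := to_member (inAP X).
pose inB (Y : B) : D := to_member (inBP Y).
have inBE Y : val (inB Y) = v |: val Y by [].
have inA_inj : injective inA by move=> X Y [] /val_inj.
have inA_inB X Y : inA X != inB Y.
  apply: contra (vA X) => /eqP XY.
  by rewrite (congr1 val XY : val X = v |: val Y) setU11.
have D_split (Z : D) : (exists X, Z = inA X) \/ (exists Y, Z = inB Y).
  have [vZ|vZ] := boolP (v \in val Z); [right | left].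
    have ZP : val Z :\ v \in IS (S :\: N).
      by rewrite -setU1_within_setU1 ?setD11 // setD1K // (valP Z).
    by exists (to_member ZP); apply: val_inj; rewrite /= setD1K.
  have ZP : val Z \in IS S by rewrite -(within_setU1 _ vZ) (valP Z).
  by exists (to_member ZP); apply: val_inj.
have cardB : #|B| < #|A|.
  rewrite !card_sig; apply/proper_card/properP; split.
    apply/subsetP => X; rewrite ![_ \in IS _]inE => /andP[-> XS] /=.
    exact: subset_trans XS (subsetDl _ _).
  exists [set u]; first exact: within_set1.
  by rewrite inE sub1set !inE avu andbF.
have cardA : 4 < #|A| by rewrite card_sig.
(* Each vertex contributes its pair of actions on [A] and [B]; the pair of [v] is trivial. *)
pose gens := [set (toggle_perm (IS S) e, toggle_perm (IS (S :\: N)) e) | e : V].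
pose H := <<gens>>%G.
have altH : 'Alt_A \subset fst @* H.
  suff -> : fst @* H = toggle_group (IS S) by [].
  rewrite morphim_gen ?subsetT // morphimEsub ?subsetT // -imset_comp.
  by congr <<_>>.
have HK := Alt_fst_ker_snd cardA cardB altH.
pose T := toggle_group (IS (v |: S)).
pose realised (d : {perm D}) (w : {perm A} * {perm B}) :=
  [forall X, d (inA X) == inA (w.1 X)] && [forall Y, d (inB Y) == inB (w.2 Y)].
(* [Q] collects the pairs induced by elements of [T] that preserve both copies. As [Q] is a group,
   [H] lies in it once the generators do. *)
pose Q := [set w | [exists d in T, realised d w]].
have gQ : group_set Q.
  apply/group_setP; split => [|w1 w2].
    rewrite inE; apply/exists_inP; exists 1; rewrite ?group1 //.
    by apply/andP; split; apply/forallP => X; rewrite !perm1.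
  rewrite !inE => /exists_inP[d1 d1T /andP[/forallP A1 /forallP B1]].
  case/exists_inP=> d2 d2T /andP[/forallP A2 /forallP B2].
  apply/exists_inP; exists (d1 * d2); first exact: groupM.
  apply/andP; split; apply/forallP => X; rewrite !permM.
    by rewrite (eqP (A1 X)) (eqP (A2 _)).
  by rewrite (eqP (B1 X)) (eqP (B2 _)).
have HQ : H \subset Group gQ.
  rewrite gen_subG; apply/subsetP => _ /imsetP[e _ ->]; rewrite inE.
  apply/exists_inP; have [->|ev] := eqVneq e v.
    exists 1; rewrite ?group1 // !toggle_within_notin ?inE ?(negPf vS) ?andbF //.
    by apply/andP; split; apply/forallP => X; rewrite !perm1.
  exists (toggle_perm (IS (v |: S)) e); first exact: mem_toggle_group.
  apply/andP; split; apply/forallP => X; apply/eqP/val_inj/setP => x.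
    rewrite /= toggle_permE /= toggle_permE.
    rewrite !in_toggle_set; try exact: within_hereditary; last 2 first.
    - exact: (valP X).
    - exact: inAP.
    by rewrite within_setU1 // in_setU1 negb_or eq_sym ev vA.
  rewrite /= toggle_permE /= in_setU1 toggle_permE.
  rewrite !in_toggle_set; try exact: within_hereditary; last 2 first.
  - exact: (valP X).
  - exact: inBP.
  rewrite /= !in_setU1 (negPf ev) /= setUCA setU1_within_setU1; last first.
    by rewrite in_setU1 negb_or eq_sym ev vB.
  by case: (x =P e) => [->|//]; rewrite (negPf ev).
have cycA (a b c : A) : a != b -> a != c ->
    tperm (inA a) (inA b) * tperm (inA a) (inA c) \in T.
  move=> ab ac; pose p : {perm A} := tperm a b * tperm a c.
  have pAlt : p \in 'Alt_A by rewrite Alt_even odd_permM !odd_tperm ab ac.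
  (* The pair [(p, 1)] lifts to an element of [T] acting as [p] on the copy of [A] and fixing the
     copy of [B] pointwise. *)
  have := subsetP HQ _ (HK p pAlt); rewrite inE.
  case/exists_inP=> d dT /andP[/forallP dA /forallP dB].
  suff <- : d = tperm (inA a) (inA b) * tperm (inA a) (inA c) by [].
  apply/permP => Z; have [[X ->]|[Y ->]] := D_split Z.
    by rewrite (eqP (dA X)) /= !permM !(inj_tperm _ _ _ inA_inj).
  by rewrite (eqP (dB Y)) /= perm1 permM !tpermD.
pose a1 : A := to_member (within_set1 uS).
pose a2 : A := to_member (within_set2 uS wS nuw).
have a12 : a1 != a2.
  apply: contra wu => /eqP[/setP/(_ w)]; rewrite !inE eqxx orbT.
  exact: id.
have tv (a : A) : u \in val a ->
    toggle_perm (IS (v |: S)) v (inA a) = inA a.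
  by move=> ua; apply: (@toggle_within_adj _ u).
apply: (@Alt_sub_3cycles _ _ (inA a1) (inA a2)); first by rewrite (inj_eq inA_inj).
have cyc (x : D) : v \notin val x -> x != inA a1 ->
    tperm (inA a1) (inA a2) * tperm (inA a1) x \in T.
  have [[X ->] _|[Y ->]] := D_split x; last by rewrite inBE setU11.
  by rewrite (inj_eq inA_inj) eq_sym; exact: cycA.
move=> x x1 x2; have [vx|] := boolP (v \in val x); last by move/cyc; apply.
set t := toggle_perm (IS (v |: S)) v.
have t1 : t (inA a1) = inA a1 by rewrite tv //= set11.
have t2 : t (inA a2) = inA a2 by rewrite tv //= !inE eqxx.
have tK : t (t x) = x by exact: toggle_permK.
(* The toggle at [v] takes [v] out of [x], which reduces to the case treated in [cyc]. *)
suff : tperm (inA a1) (inA a2) * tperm (inA a1) (t x) \in T.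
  by move/groupJ/(_ (mem_toggle_group _ v)); rewrite conjMg !tpermJ -/t t1 t2 tK.
apply: cyc.
  rewrite toggle_permE in_toggle_set ?eqxx ?(valP x) ?vx //.
  exact: within_hereditary.
by rewrite -t1 (inj_eq perm_inj).
Qed.
(** The edge has an end [z] other than [u] and [w], since these two are not adjacent. The empty set,
    the three singletons and the pair of [u] and [w] make five sets. *)
Lemma card_within_gt4 (S : {set V}) (a b u w : V) :
    a \in S -> b \in S -> adj a b -> u \in S -> w \in S -> w != u -> ~~ adj u w ->
  4 < #|IS S|.
Proof.
move=> aS bS ab uS wS wu nuw.
have [z zS /andP[zu zw]] : exists2 z, z \in S & (z != u) && (z != w).
  have [au|au] := eqVneq a u; last have [aw|aw] := eqVneq a w.
  - subst a; exists b => //; apply/andP; split.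
      by apply: contraTneq ab => ->; rewrite adj_irr.
    by apply: contraNneq nuw => <-.
  - subst a; exists b => //; apply/andP; split.
      by apply: contraNneq nuw => <-; rewrite adj_sym.
    by apply: contraTneq ab => ->; rewrite adj_irr.
  - by exists a; rewrite ?au.
pose s := [:: set0; [set u]; [set w]; [set z]; [set u; w]].
have us : uniq s.
  have ne (x : V) (X Y : {set V}) : x \in Y -> x \notin X -> X != Y.
    by move=> xY; apply: contraNneq => ->.
  rewrite /= !inE !negb_or !andbT; apply/and4P; split.
  - by apply/and4P; split;
      [apply: (ne u) | apply: (ne w) | apply: (ne z) | apply: (ne u)];
      rewrite ?inE ?eqxx.
  - by apply/and3P; split; [apply: (ne w) | apply: (ne z) | apply: (ne w)];
      rewrite ?inE ?eqxx ?orbT.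
  - by apply/andP; split; [apply: (ne z) | apply: (ne u)];
      rewrite ?inE ?eqxx // eq_sym.
  - by rewrite eq_sym (ne z) ?inE ?eqxx // negb_or zu.
have sub : {subset s <= enum (IS S)}.
  move=> X; rewrite mem_enum !in_cons orbF.
  case/or4P=> [/eqP->|/eqP->|/eqP->|/orP[]/eqP->]; rewrite ?within_set0 ?within_set1 //.
  exact: within_set2.
by have := uniq_leq_size us sub; rewrite -cardE.
Qed.

(* Since G is connected, V is exhausted one vertex at a time, each new vertex
   being adjacent to an earlier one. *)
Lemma connected_toggle_alternating :
  connected_graph adj -> toggle_alternating (independent_sets adj).
Proof.
move=> conn; rewrite -independent_withinT.
have [[a [b ab]]|noE] : (exists a b, adj a b) \/ (forall a b, ~~ adj a b).
  case: (pickP (fun p : V * V => adj p.1 p.2)) => [[a b] /= ab|noE].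
    by left; exists a, b.
  by right => a b; rewrite (noE (a, b)).
(* A maximal [S] with property [P] is shown to be everything. Keeping the edge inside [S] guarantees
   the five sets needed to extend it. *)
- pose P (S : {set V}) := [&& a \in S, b \in S &
    'Alt_(member (IS S)) \subset toggle_group (IS S)].
  have P2 : P [set a; b].
    rewrite /P !inE !eqxx orbT /= (@toggle_group_dominating _ a) ?subsetT ?set21 //.
    by move=> x /set2P[->|->]; rewrite ?eqxx // adj_sym.
  have [S /maxsetP[/and3P[aS bS altS] maxS] _] := maxset_exists P2.
  suff -> : [set: V] = S by [].
  apply/eqP; rewrite eq_sym eqEsubset subsetT /=; apply: contraT => /subsetPn[z _ zS].
  have [u [v [uS vS avu]]] : exists u v, [/\ u \in S, v \notin S & adj v u].
    (* The path from [a] to [z] starts inside [S] and ends outside; the first edge leaving [S] gives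
       [u] and [v]. *)
    case/connectP: (conn a z) => p; move: (a) aS; elim: p => [|y p IHp] x xS /=.
      by move=> _ zx; rewrite zx xS in zS.
    case/andP=> xy pth zl; have [yS|yS] := boolP (y \in S); first exact: IHp pth zl.
    by exists x, y; rewrite adj_sym.
  suff altS' : toggle_alternating (IS (v |: S)).
    by rewrite -(maxS (v |: S)) ?setU11 ?subsetUr //  /P !setU1r in vS *.
  have [/forall_inP domu|] :=
      boolP [forall x in v |: S, (x != u) ==> adj x u].
    rewrite /toggle_alternating (@toggle_group_dominating _ u) ?subsetT ?setU1r //.
    by move=> x /domu/implyP.
  case/forall_inPn=> w wS'; rewrite negb_imply => /andP[wu]; rewrite adj_sym => nuw.
  have wS : w \in S.
    by case/setU1P: wS' nuw => // ->; rewrite adj_sym avu.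
  apply: (toggle_alternating_setU1 vS uS avu wS wu nuw) => //.
  exact: card_within_gt4 aS bS ab uS wS wu nuw.
(* Without edges a connected graph has at most one vertex. A single vertex dominates vacuously, and
   the empty graph has only one independent set. *)
have Vsub (x y : V) : x = y.
  case/connectP: (conn x y) => -[|z p] //= /andP[xz].
  by rewrite (negPf (noE x z)) in xz.
have [u _|V0] := pickP (@predT V).
  rewrite /toggle_alternating (@toggle_group_dominating _ u) ?subsetT ?inE //.
  by move=> x _; rewrite (Vsub x u) eqxx.
apply/subsetP => p _; suff -> : p = 1 by exact: group1.
by apply/permP => X; apply: val_inj; apply/setP => x; have := V0 x.
Qed.

End IndependentSets.

(** * Product decomposition over the components *)

Section Components.

Variables (V : finType) (adj : rel V).
Hypotheses (adj_sym : symmetric adj) (adj_irr : irreflexive adj).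
Variables (k : nat) (C : 'I_k -> {set V}).
Hypotheses (C_cover : forall x, exists i, x \in C i)
  (C_disj : forall x i j, x \in C i -> x \in C j -> i = j)
  (C_adj : forall x y i, x \in C i -> adj x y -> y \in C i).

Local Notation L := (independent_sets adj).
Local Notation Lc i := (independent_sets (induced adj (C := C i))).

(** Presents a vertex as an element of the subtype of its block, the form in which [in_restrict] and
    [in_combine_set] apply. *)
Lemma component_elim (P : V -> Prop) :
  (forall i (x : {x : V | x \in C i}), P (val x)) -> forall v, P v.
Proof. by move=> Pval v; have [i vi] := C_cover v; exact: (Pval i (exist _ v vi)). Qed.

Lemma restrict_independent i (X : member L) :
  [set x : {x : V | x \in C i} | val x \in val X] \in Lc i.
Proof.
rewrite inE; apply/independentP => x y; rewrite !inE => xX yX.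
by move: (valP X); rewrite inE => /independentP; apply.
Qed.

Definition restrict i (X : member L) : member (Lc i) :=
  to_member (restrict_independent i X).

Lemma in_restrict i (X : member L) (x : {x : V | x \in C i}) :
  (x \in val (restrict i X)) = (val x \in val X).
Proof. by rewrite inE. Qed.

Lemma restrict_inj (X Y : member L) :
  (forall i, restrict i X = restrict i Y) -> X = Y.
Proof.
move=> XY; apply/val_inj/setP; apply: component_elim => i x.
by rewrite -!in_restrict XY.
Qed.

Definition combine_set (Y : forall i, member (Lc i)) : {set V} :=
  \bigcup_i val @: val (Y i).

Lemma in_combine_set (Y : forall i, member (Lc i)) i (x : {x : V | x \in C i}) :
  (val x \in combine_set Y) = (x \in val (Y i)).
Proof.
apply/bigcupP/idP => [[j _ /imsetP[y yY xy]]|xY]; last first.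
  by exists i => //; exact: imset_f.
have ij : i = j by apply: C_disj (valP x) _; rewrite xy (valP y).
by subst j; rewrite (val_inj xy).
Qed.

Lemma combine_independent (Y : forall i, member (Lc i)) : combine_set Y \in L.
Proof.
rewrite inE; apply/independentP; apply: component_elim => i x v.
rewrite in_combine_set => xY vY; apply/negP => axv.
have vi := C_adj (valP x) axv.
move: vY axv; rewrite -[v]/(val (exist (fun z => z \in C i) v vi)) in_combine_set.
move: (valP (Y i)); rewrite inE => /independentP iY yY.
by apply/negP; exact: iY.
Qed.

Definition combine (Y : forall i, member (Lc i)) : member L :=
  to_member (combine_independent Y).

Lemma restrict_combine (Y : forall i, member (Lc i)) i :
  restrict i (combine Y) = Y i.
Proof. by apply/val_inj/setP => x; rewrite in_restrict in_combine_set. Qed.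

Implicit Types p q : {dffun forall i, {perm member (Lc i)}}.

Lemma componentwise_inj p :
  injective (fun X => combine (fun i => p i (restrict i X))).
Proof.
move=> X Y XY; apply: restrict_inj => i; apply: (@perm_inj _ (p i)).
by have := congr1 (restrict i) XY; rewrite !restrict_combine.
Qed.

Definition componentwise p : {perm member L} := perm (@componentwise_inj p).

Lemma restrict_componentwise p i (X : member L) :
  restrict i (componentwise p X) = p i (restrict i X).
Proof. by rewrite permE restrict_combine. Qed.

Lemma componentwiseM : {in setT &, {morph componentwise : p q / p * q}}.
Proof.
move=> p q _ _; apply/permP => X; apply: restrict_inj => i.
by rewrite permM !restrict_componentwise ffunE permM.
Qed.

Canonical componentwise_morphism := Morphism componentwiseM.

(** Every member of a factor is the restriction of some member of [L], so [componentwise p]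
    determines each [p i]. *)
Lemma injm_componentwise : 'injm componentwise_morphism.
Proof.
apply/subsetP => p /kerP pK; apply/set1P/ffunP => i; rewrite ffunE.
apply/permP => Y; rewrite perm1.
(* [Y] sits in slot [i], the empty set in every other slot. *)
pose X := combine (dfwith (fun j => restrict j (to_member (independent_set0 adj))) Y).
have <- : restrict i X = Y by rewrite restrict_combine dfwith_in.
by rewrite -restrict_componentwise pK ?inE // perm1.
Qed.

(** All neighbours of [e] lie in [C i], so whether [e] may be inserted is decided inside its
    block. *)
Lemma independent_setU1_restrict i (X : member L) (e : {x : V | x \in C i}) :
  (e |: val (restrict i X) \in Lc i) = (val e |: val X \in L).
Proof.
rewrite !independent_setU1 //; first 1 last.
- by move=> x y; exact: adj_sym.
- by move=> x; exact: adj_irr.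
rewrite (valP X) (valP (restrict i X)) /=.
apply/forall_inP/forall_inP => nX x xX; last by apply: nX; rewrite -in_restrict.
apply/negP => ax; have xi := C_adj (valP e) ax.
by have := nX (exist _ x xi); rewrite in_restrict => /(_ xX); rewrite /induced ax.
Qed.

Lemma componentwise_toggle i (e : {x : V | x \in C i}) :
  componentwise (dfung1 (toggle_perm (Lc i) e)) = toggle_perm L (val e).
Proof.
apply/permP => X; apply: restrict_inj => j; rewrite restrict_componentwise.
apply/val_inj/setP => x; rewrite in_restrict toggle_permE.
rewrite in_toggle_set ?(valP X) //; last exact: independent_hereditary.
have [ij|ij] := eqVneq i j.
  subst j; rewrite dfung1_id toggle_permE in_toggle_set; first 1 last.
  - exact: independent_hereditary.
  - exact: (valP (restrict i X)).
  by rewrite !in_restrict independent_setU1_restrict val_eqE.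
rewrite dfung1_dflt // perm1 in_restrict ifF //.
apply: contraNF ij => /eqP xe; apply/eqP.
by apply: C_disj (valP e) _; rewrite -xe (valP x).
Qed.

Lemma toggle_group_components :
  toggle_group L \isog setXn (fun i => toggle_group (Lc i)).
Proof.
rewrite isog_sym.
suff <- : componentwise_morphism @* setXn (fun i => toggle_group (Lc i)) =
    toggle_group L.
  by apply: sub_isog (subsetT _) injm_componentwise.
apply/eqP; rewrite eqEsubset; apply/andP; split.
  (* The product is generated by its embedded factors, and each factor by its toggles. *)
  rewrite sub_morphim_pre ?subsetT // -setXn_prod prod_subG // => i _.
  rewrite -morphim_dfung1 morphim_gen ?subsetT // gen_subG.
  apply/subsetP => _ /morphimP[_ _ /imsetP[e _ ->] ->].
  by rewrite mem_morphpre ?inE //= componentwise_toggle mem_toggle_group.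
rewrite gen_subG; apply/subsetP => _ /imsetP[v _ ->].
elim/component_elim: v => i e.
rewrite -componentwise_toggle; apply: (mem_morphim componentwise_morphism (in_setT _)).
apply/setXnP => j; have [ij|ij] := eqVneq i j.
  by subst j; rewrite dfung1_id mem_toggle_group.
by rewrite dfung1_dflt // group1.
Qed.

End Components.

Theorem corollary3p24 (V : finType) (adj : rel V)
    (adj_sym : symmetric adj) (adj_irr : irreflexive adj) :
  (connected_graph adj -> toggle_alternating (independent_sets adj)) /\
  (forall (k : nat) (C : 'I_k -> {set V}),
     injective C -> [set C i | i : 'I_k] = components adj ->
     toggle_group (independent_sets adj) \isog
       setXn (fun i : 'I_k =>
         toggle_group (independent_sets (induced adj (C := C i))))).
Proof.
split; first exact: connected_toggle_alternating.
move=> k C injC compC.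
have csym := sym_connect_sym adj_sym.
(* Each block is a full connectivity class; this yields closure under edges and, with [injC],
   disjointness. *)
have Cblock i x y : x \in C i -> (y \in C i) = connect adj x y.
  have : C i \in components adj by rewrite -compC imset_f.
  case/imsetP=> z _ ->; rewrite !inE => zx.
  exact: (same_connect csym zx).
apply: toggle_group_components => // [x|x i j xi xj|x y i xi axy].
- have : [set y in setT | connect adj x y] \in components adj by exact: imset_f.
  by rewrite -compC => /imsetP[i _ Ci]; exists i; rewrite -Ci !inE connect0.
- by apply/injC/setP => y; rewrite (Cblock i x y xi) (Cblock j x y xj).
- by rewrite (Cblock i x y xi) connect1.
Qed.
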